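(* Let $\alpha>0$ and $\beta\in\mathbb{R}$, and put $\beta_-:=\max(-\beta,0)$. Then $m(\alpha+\beta\delta_0)=2\sqrt{\alpha}-\beta_-$. In particular, if $2\sqrt{\alpha}+\beta>0$, then the inequality $$\|u\|_\infty\le C\left(\int_{\mathbb{R}}\big(|u'(x)|^2+\alpha|u(x)|^2\big)\,dx+\beta|u(0)|^2\right)^{1/2}\qquad(u\in H^1(\mathbb{R}))$$ holds, and its best (smallest) constant is $C=(2\sqrt{\alpha}-\beta_-)^{-1/2}$.
   Context: Elements of $H^1(\mathbb{R})$ are identified with their continuous representatives; $\|u\|_\infty:=\|u\|_{L^\infty(\mathbb{R})}$. For a bounded symmetric bilinear form $V$ on $H^1(\mathbb{R})$ set $I(u;V):=\|u'\|_{L^2(\mathbb{R})}^2+V(u,u)$ and $m(V):=\inf_{u\in H^1(\mathbb{R}),\,u\not\equiv0} I(u;V)/\|u\|_\infty^2$. Here $\alpha+\beta\delta_0$ denotes the form $(u,v)\mapsto\int_{\mathbb{R}}\alpha uv\,dx+\beta u(0)v(0)$. *)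

(* Defs.v *)
From mathcomp Require Import all_boot all_order all_algebra.
From mathcomp Require Import all_classical all_reals all_analysis.
Import Order.TTheory GRing.Theory Num.Theory.
Import numFieldNormedType.Exports.
Local Open Scope classical_set_scope.
Local Open Scope ring_scope.

Set Implicit Arguments.
Unset Strict Implicit.
Unset Printing Implicit Defensive.

Section H1Defs.
Variable R : realType.
Local Notation mu := (@lebesgue_measure R).

Definition test_fun (phi : R -> R) : Prop :=
  (forall (n : nat) (x : R), derivable (derive1n n phi) x 1) /\
  (exists M : R, forall x : R, M < `|x| -> phi x = 0).

Definition L2fun (f : R -> R) : Prop :=
  measurable_fun setT f /\ (\int[mu]_x ((f x) ^+ 2)%:E < +oo)%E.

Definition L2norm2 (f : R -> R) : R := fine (\int[mu]_x ((f x) ^+ 2)%:E).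

Definition weak_deriv (u g : R -> R) : Prop :=
  forall phi : R -> R, test_fun phi ->
    (\int[mu]_x (u x * derive1 phi x)%:E = - \int[mu]_x (g x * phi x)%:E)%E.

(* u ∈ H^1(R) (continuous representative) with weak derivative u' = g *)
Definition H1_with_deriv (u g : R -> R) : Prop :=
  continuous u /\ L2fun u /\ L2fun g /\ weak_deriv u g.

(* ‖u‖_∞ (for continuous u this is the L^∞ norm) *)
Definition sup_norm (u : R -> R) : R := sup [set `|u x| | x in setT].

Definition alpha_delta_form (alpha beta : R) (u v : R -> R) : R :=
  fine (\int[mu]_x (alpha * u x * v x)%:E) + beta * u 0 * v 0.

Definition Ifun (V : (R -> R) -> (R -> R) -> R) (u g : R -> R) : R :=
  L2norm2 g + V u u.

Definition mV (V : (R -> R) -> (R -> R) -> R) : R :=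
  inf [set Ifun V ug.1 ug.2 / sup_norm ug.1 ^+ 2 |
        ug in [set ug : (R -> R) * (R -> R) |
                 H1_with_deriv ug.1 ug.2 /\ exists x, ug.1 x != 0]].

End H1Defs.

(* Main.v *)
Require Import Defs.
From mathcomp Require Import all_boot all_order all_algebra.
From mathcomp Require Import all_classical all_reals all_analysis.
From mathcomp Require Import ring lra measurable_realfun.
Import Order.TTheory GRing.Theory Num.Theory.
Import numFieldNormedType.Exports.
Local Open Scope classical_set_scope.
Local Open Scope ring_scope.

(* Write a = sqrt alpha and p(x) = exp(- a |x - y|), the Green function of
   - u'' + a^2 u up to the factor 2a.  Since p'' = a^2 p - 2a delta_y, testing
   u' with p' gives 2 a u(y) = a^2 <u, p> + <u', p'>, and completing the squares
   |a u - c a p|^2 + |u' - c p'|^2 >= 0 with c = u(y) yields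
   2 a u(y)^2 <= |u'|^2 + a^2 |u|^2.  As the weak derivative only sees smooth
   compactly supported functions, p' is replaced by smooth truncations of
   - a sgn(x - y) p, vanishing near y and far from it; the derivative of the
   truncation then contributes an approximation of the point mass at y.
   The lower bound on m follows from beta u(0)^2 >= - beta_- |u|_oo^2, and it is
   approached by the peaks p themselves: centred at 0 if beta <= 0, and with
   centre escaping to infinity if beta > 0. *)

Set Implicit Arguments.
Unset Strict Implicit.

(** * Smooth functions *)

Section SmoothFunctions.
Variable R : realType.
Implicit Types (f g : R -> R) (p : {poly R}).

(** For [p = 1] this is exp(- 1/x) extended by 0, the standard smooth function that is not analytic.
    The factor [p.[x^-1]] makes the family stable under differentiation. *)
Definition flat p (x : R) : R := if 0 < x then p.[x^-1] * expR (- x^-1) else 0.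

(* Closed under differentiation, hence consisting of smooth functions. *)
Inductive elementary : (R -> R) -> Prop :=
| elementary_flat p : elementary (flat p)
| elementary_cst c : elementary (fun=> c)
| elementary_id : elementary id
| elementary_exp : elementary expR
| elementary_add f g :
    elementary f -> elementary g -> elementary (fun x => f x + g x)
| elementary_mul f g :
    elementary f -> elementary g -> elementary (fun x => f x * g x)
| elementary_inv f :
    elementary f -> (forall x, f x != 0) -> elementary (fun x => (f x)^-1)
| elementary_comp f g :
    elementary f -> elementary g -> elementary (fun x => f (g x)).

(** For x >= 0 each monomial x^i is at most i! exp(x), by a single term of the exponential
    series. *)
Lemma poly_le_exp p : exists2 C : R, 0 <= C &
  forall x, 0 <= x -> `|p.[x]| <= C * expR x.
Proof.
exists (\sum_(i < size p) `|p`_i| * i`!%:R) => [|x x0].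
  by apply: sumr_ge0 => i _; exact: mulr_ge0.
rewrite horner_coef mulr_suml; apply: (le_trans (ler_norm_sum _ _ _)).
apply: ler_sum => i _; rewrite normrM -mulrA ler_wpM2l// normrX ger0_norm//.
case: i => -[|i] _ /=; first by rewrite expr0 fact0 mul1r -expR0 ler_expR.
have := expR_ge1Dxn i x0; rewrite -lerBrDl => h.
rewrite mulrC -ler_pdivrMr ?ltr0n ?fact_gt0//.
by rewrite (le_trans h)// gerBl.
Qed.

(** The exponential bound for [p * 'X^2] at [x^-1] leaves two powers of [x] to spare, which makes
    the difference quotient at 0 tend to 0. *)
Lemma flat_le p : exists2 C : R, 0 <= C & forall x, `|flat p x| <= C * x ^+ 2.
Proof.
have [C C0 hC] := poly_le_exp (p * 'X^2).
exists C => // x; rewrite /flat; case: ltP => x0; last first.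
  by rewrite normr0 mulr_ge0// sqr_ge0.
have y0 : 0 <= x^-1 by rewrite invr_ge0 ltW.
have := hC _ y0; rewrite hornerM hornerXn normrM normrX (ger0_norm y0) => h.
rewrite normrM (ger0_norm (expR_ge0 _)) expRN ler_pdivrMr ?expR_gt0//.
rewrite -mulrA [x ^+ 2 * _]mulrC mulrA -ler_pdivrMr ?exprn_gt0//.
by rewrite exprVn in h.
Qed.

(** With w = 1/x and dw/dx = - w^2, the derivative of p(w) exp(- w) is w^2 (p(w) - p'(w)) exp(- w).
    At 0 the quadratic bound applies. *)
Lemma is_derive_flat p (x : R) :
  is_derive x 1 (flat p) (flat ('X^2 * (p - p^`())) x).
Proof.
have [x0|x0|->] := ltgtP x 0.
- rewrite [flat (_ * _) x]/flat ltNge (ltW x0)/=.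
  apply: (@near_eq_is_derive _ R R (cst (0 : R))).
  near=> z; rewrite /flat ifN// -leNgt ltW//.
  by near: z; exact: lt_nbhsl.
- apply: (@near_eq_is_derive _ R R (fun x => p.[x^-1] * expR (- x^-1))).
    near=> z; rewrite /flat ifT//.
    by near: z; exact: lt_nbhsr.
  have xn0 : x != 0 by rewrite gt_eqF.
  have dV : is_derive x 1 (fun z : R => z^-1) (- x ^- 2).
    have := @is_deriveV R id x 1 1 xn0 _; rewrite /GRing.scale/= mulr1; exact.
  have dp : is_derive x 1 (fun z : R => p.[z^-1]) (p^`().[x^-1] * (- x ^- 2)).
    exact: (@is_derive1_comp R (horner p) (fun z : R => z^-1)).
  have de : is_derive x 1 (fun z : R => expR (- z^-1)) (expR (- x^-1) * x ^- 2).
    have dN := is_deriveN dV; rewrite opprK in dN.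
    exact: (@is_derive1_comp R expR (fun z : R => - z^-1)).
  apply: is_derive_eq (is_deriveM dp de) _.
  rewrite /flat x0 /GRing.scale/= !hornerE/= exprVn; ring.
- have [C C0 hC] := flat_le p.
  have h0 : flat ('X^2 * (p - p^`())) 0 = 0 by rewrite /flat ltxx.
  have f0 : flat p 0 = 0 by rewrite /flat ltxx.
  have lim0 : h^-1 *: (flat p (h *: 1 + 0) - flat p 0) @[h --> 0^'] --> 0.
    apply/cvgrPdist_le => e e0; near=> h.
    rewrite sub0r normrN f0 subr0 addr0 /GRing.scale/= mulr1 normrM normfV.
    have h_neq0 : h != 0 by near: h; exact: nbhs_dnbhs_neq.
    rewrite ler_pdivrMl ?normr_gt0//.
    apply: (le_trans (hC h)); rewrite -real_normK ?num_real// expr2 mulrA mulrC ler_wpM2l//.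
    (* [C] may be 0, hence the denominator [C + 1]. *)
    have : `|h| <= e / (C + 1).
      near: h; apply: (@dnbhs0_le _ R).
      by rewrite divr_gt0// ltr_wpDl.
    rewrite ler_pdivlMr ?ltr_wpDl// => hh.
    by rewrite (le_trans _ hh)// mulrC ler_wpM2l// lerDl.
  apply: DeriveDef; first by apply/cvg_ex; exists 0.
  by rewrite h0; apply: cvg_lim.
Unshelve. all: by end_near. Qed.

Lemma elementary_derive f : elementary f ->
  exists2 f', elementary f' & forall x : R, is_derive x (1 : R) f (f' x).
Proof.
elim=> {f} [p|c|||f g _ [f' ef' df] _ [g' eg' dg]|f g ef [f' ef' df] eg [g' eg' dg]
  |f ef [f' ef' df] f0|f g ef [f' ef' df] eg [g' eg' dg]].
- by exists (flat ('X^2 * (p - p^`()))); [constructor|exact: is_derive_flat].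
- by exists (fun=> 0); [constructor|move=> x; exact: is_derive_cst].
- by exists (fun=> 1); [constructor|move=> x; exact: is_derive_id].
- by exists expR; [constructor|move=> x; exact: is_derive_expR].
- by exists (fun x => f' x + g' x); [constructor|move=> x; exact: is_deriveD].
- exists (fun x => f x * g' x + g x * f' x); first by do 2 constructor.
  by move=> x; exact: is_deriveM.
- exists (fun x => -1 * ((f x)^-1 * (f x)^-1) * f' x).
    by apply: elementary_mul => //; apply: elementary_mul; constructor=> //; constructor.
  move=> x; have := @is_deriveV R f x (f' x) 1 (f0 x) (df x).
  by rewrite /GRing.scale/= mulN1r -expr2 exprVn.
- exists (fun x => f' (g x) * g' x).
    by apply: elementary_mul => //; exact: elementary_comp.
  by move=> x; exact: (@is_derive1_comp R f g).
Qed.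

Lemma elementary_smooth f : elementary f ->
  forall n x, derivable (derive1n n f) x (1 : R).
Proof.
move=> ef n x; suff /elementary_derive[g _ dg] : elementary (derive1n n f).
  by have [] := dg x.
elim: n => // n /elementary_derive[g eg dg].
rewrite derive1nS (_ : derive1 _ = g)//.
by apply/funext => z; rewrite derive1E; have [_ ->] := dg z.
Qed.

Lemma elementary_continuous f : elementary f -> continuous f.
Proof.
move=> ef x; apply/differentiable_continuous/derivable1_diffP.
exact: elementary_smooth ef 0%N x.
Qed.

(** * A smooth step from 0 to 1 *)

Definition smooth_step x := flat 1 x / (flat 1 x + flat 1 (1 - x)).

Lemma flat1_ge0 x : 0 <= flat 1 x.
Proof. by rewrite /flat; case: ifP; rewrite // hornerE mul1r expR_ge0. Qed.

Lemma flat1_gt0 x : 0 < x -> 0 < flat 1 x.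
Proof. by rewrite /flat => ->; rewrite hornerE mul1r expR_gt0. Qed.

Lemma flat_le0 p x : x <= 0 -> flat p x = 0.
Proof. by rewrite /flat leNgt => /negbTE ->. Qed.

(** [x] and [1 - x] are never both nonpositive. *)
Lemma smooth_step_den_gt0 x : 0 < flat 1 x + flat 1 (1 - x).
Proof.
have [x0|x0] := ltP 0 x; first by rewrite ltr_wpDr ?flat1_ge0// flat1_gt0.
by rewrite ltr_wpDl ?flat1_ge0// flat1_gt0// subr_gt0 (le_lt_trans x0).
Qed.

Lemma elementary_affine b c f : elementary f ->
  elementary (fun x => f (b + c * x)).
Proof.
move=> ef; apply: elementary_comp => //.
by apply: elementary_add; [|apply: elementary_mul]; constructor.
Qed.

Lemma elementary_smooth_step : elementary smooth_step.
Proof.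
apply: elementary_mul; first by constructor.
apply: elementary_inv => [|x]; last by rewrite gt_eqF// smooth_step_den_gt0.
apply: elementary_add; first by constructor.
rewrite (_ : (fun x => _) = fun x => flat 1 (1 + -1 * x)); last first.
  by apply/funext => x; rewrite mulN1r.
by apply: elementary_affine; constructor.
Qed.

Lemma smooth_step_ge0 x : 0 <= smooth_step x.
Proof. by rewrite divr_ge0 ?flat1_ge0// ltW// smooth_step_den_gt0. Qed.

Lemma smooth_step_le1 x : smooth_step x <= 1.
Proof.
by rewrite ler_pdivrMr ?smooth_step_den_gt0// mul1r lerDl flat1_ge0.
Qed.

Lemma smooth_step_le0 x : x <= 0 -> smooth_step x = 0.
Proof. by move=> x0; rewrite /smooth_step flat_le0// mul0r. Qed.

Lemma smooth_step_ge1 x : 1 <= x -> smooth_step x = 1.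
Proof.
move=> x1; have x0 : 0 < x by exact: lt_le_trans x1.
rewrite /smooth_step (@flat_le0 1 (1 - x)) ?subr_le0// addr0 divff// gt_eqF//.
exact: flat1_gt0.
Qed.

Lemma smooth_step_derive : exists2 s', elementary s' &
  [/\ forall x : R, is_derive x (1 : R) smooth_step (s' x),
      forall x, x < 0 -> s' x = 0, forall x, 1 < x -> s' x = 0 &
      exists2 K, 0 <= K & forall x, `|s' x| <= K].
Proof.
have [s' es' ds'] := elementary_derive elementary_smooth_step.
have s'0 (x : R) : x < 0 -> s' x = 0.
  move=> x0; have [_ <-] := ds' x.
  rewrite (@near_eq_derive _ R R _ (cst (0 : R))) ?derive_cst//.
  by near=> z; rewrite smooth_step_le0// ltW//; near: z; exact: lt_nbhsl.
have s'1 x : 1 < x -> s' x = 0.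
  move=> x0; have [_ <-] := ds' x.
  rewrite (@near_eq_derive _ R R _ (cst (1 : R))) ?derive_cst//.
  by near=> z; rewrite smooth_step_ge1// ltW//; near: z; exact: lt_nbhsr.
exists s' => //; split=> //.
have cs' : continuous (fun x => `|s' x|).
  by move=> z; apply: continuous_comp;
    [exact: elementary_continuous|exact: norm_continuous].
have [c _ hc] := @EVT_max R _ 0 1 ler01 (continuous_subspaceT cs').
exists `|s' c| => // x; have [x0|x0] := ltP x 0; first by rewrite s'0// normr0.
have [x1|x1] := ltP 1 x; first by rewrite s'1// normr0.
by apply: hc; rewrite in_itv/= x0 x1.
Unshelve. all: by end_near. Qed.

End SmoothFunctions.

(** * Square-integrable functions and exponential peaks *)

Section SquareIntegrable.
Variable R : realType.
Implicit Types f g : R -> R.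
Local Notation mu := (@lebesgue_measure R).

Lemma L2fun_integrable_sqr f : L2fun f ->
  mu.-integrable setT (EFin \o (fun x => f x ^+ 2)).
Proof.
move=> [mf f2]; apply/integrableP; split.
  by apply/measurable_EFinP; exact: measurable_funX.
by under eq_integral do rewrite /= ger0_norm ?sqr_ge0//.
Qed.

(** The product is dominated by [f ^+ 2 + g ^+ 2], since (|f| - |g|)^2 >= 0. *)
Lemma L2fun_integrableM f g : L2fun f -> L2fun g ->
  mu.-integrable setT (EFin \o (fun x => f x * g x)).
Proof.
move=> Lf Lg; have [[mf _] [mg _]] := (Lf, Lg).
apply: (@le_integrable _ _ R mu _ measurableT _
    (EFin \o (fun x => f x ^+ 2 + g x ^+ 2))).
- by apply/measurable_EFinP; exact: measurable_funM.
- move=> x _; rewrite /= lee_fin normrM [leRHS]ger0_norm ?addr_ge0 ?sqr_ge0//.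
  rewrite -(real_normK (num_real (f x))) -(real_normK (num_real (g x))).
  have := sqr_ge0 (`|f x| - `|g x|).
  rewrite sqrrB; have := mulr_ge0 (normr_ge0 (f x)) (normr_ge0 (g x)); lra.
- have := @integrableD _ _ _ mu _ measurableT _ _ (L2fun_integrable_sqr Lf)
    (L2fun_integrable_sqr Lg).
  by apply: eq_integrable.
Qed.

Lemma L2norm2E f : L2fun f -> (\int[mu]_x (f x ^+ 2)%:E = (L2norm2 f)%:E)%E.
Proof.
by move=> Lf; rewrite fineK//; exact: integrable_fin_num (L2fun_integrable_sqr Lf).
Qed.

Lemma L2norm2_ge0 f : 0 <= L2norm2 f.
Proof. by apply: fine_ge0; apply: integral_ge0 => x _; rewrite lee_fin sqr_ge0. Qed.

Lemma L2fun_le f g : measurable_fun setT f -> (forall x, `|f x| <= `|g x|) ->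
  L2fun g -> L2fun f.
Proof.
move=> mf fg [mg g2]; split => //; apply: le_lt_trans g2.
apply: ge0_le_integral => //.
- by move=> x _; rewrite lee_fin sqr_ge0.
- by apply/measurable_EFinP; exact: measurable_funX.
- by apply/measurable_EFinP; exact: measurable_funX.
- move=> x _; rewrite lee_fin -(real_normK (num_real (f x))).
  by rewrite -(real_normK (num_real (g x))) lerXn2r ?nnegrE.
Qed.

Lemma L2funZ k f : L2fun f -> L2fun (fun x => k * f x).
Proof.
move=> Lf; have [mf _] := Lf; split; first exact: measurable_funM.
have /(integrableZl measurableT (k ^+ 2)) := L2fun_integrable_sqr Lf.
move=> /integrableP[_]; congr (_ < _)%E; apply: eq_integral => x _.
by rewrite gee0_abs /= -EFinM -exprMn ?lee_fin ?sqr_ge0.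
Qed.

End SquareIntegrable.

(** * Exponential peaks: integral and L^2 norm *)

Section Peak.
Variable R : realType.
Local Notation mu := (@lebesgue_measure R).

Definition peak (b y x : R) : R := expR (- (b * `|x - y|)).

Lemma peak_gt0 b y x : 0 < peak b y x. Proof. exact: expR_gt0. Qed.

Lemma peak_ge0 b y x : 0 <= peak b y x. Proof. exact: expR_ge0. Qed.

Lemma peak_le1 b y x : 0 <= b -> peak b y x <= 1.
Proof. by move=> b0; rewrite /peak -expR0 ler_expR oppr_le0 mulr_ge0. Qed.

Lemma peak_center b y : peak b y y = 1.
Proof. by rewrite /peak subrr normr0 mulr0 oppr0 expR0. Qed.

(** Squaring doubles the decay rate, which reduces L^2 norms of peaks to integrals of peaks. *)
Lemma peak_sqr b y x : peak b y x ^+ 2 = peak (b *+ 2) y x.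
Proof. by rewrite /peak -expRM_natl; congr expR; ring. Qed.

Lemma peak_continuous b y : continuous (peak b y).
Proof.
move=> x; apply: continuous_comp; last exact: continuous_expR.
apply: continuousN; apply: continuousM; first exact: cst_continuous.
apply: continuous_comp; last exact: norm_continuous.
by apply: continuousB; [exact: cvg_id|exact: cst_continuous].
Qed.

(** By symmetry this is twice the integral over the half-line, where - exp(- b x) / b is a
    primitive. *)
Lemma integral_peak0 b : 0 < b -> (\int[mu]_x (peak b 0 x)%:E = (2 / b)%:E)%E.
Proof.
move=> b0; rewrite ge0_symfun_integralT; last 3 first.
- by move=> x; exact: peak_ge0.
- exact: peak_continuous.
- by move=> x; rewrite /peak /= !subr0 normrN.
rewrite -set_itvcy EFinM; congr (_ * _)%E.
have cF (x : R) : {for x, continuous (fun x : R => - b^-1 * expR (- (b * x)))}.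
  apply: continuousM; first exact: cst_continuous.
  apply: continuous_comp; last exact: continuous_expR.
  apply: continuousN; apply: continuousM; first exact: cst_continuous.
  exact: cvg_id.
have dF (x : R) : is_derive x (1 : R) (fun x : R => - b^-1 * expR (- (b * x)))
    (expR (- (b * x))).
  have dl : is_derive x (1 : R) (fun x : R => - (b * x)) (- b).
    by apply: is_derive_eq; rewrite /GRing.scale/= mulr1.
  have de := @is_derive1_comp R expR _ x _ _ (is_derive_expR _) dl.
  apply: is_derive_eq (is_deriveZ (- b^-1) de) _.
  by rewrite /GRing.scale/= mulrN mulrNN mulrCA mulVf ?mulr1// gt_eqF.
rewrite (@ge0_continuous_FTC2y R _ (fun x => - b^-1 * expR (- (b * x))) 0 0).
- by rewrite mulr0 oppr0 expR0 mulr1 -EFinB sub0r opprK.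
- by move=> x _; exact: peak_ge0.
- by apply: continuous_subspaceT; exact: peak_continuous.
- rewrite -[X in _ --> X](mulr0 (- b^-1)); apply: cvgM; first exact: cvg_cst.
  apply: (@cvg_comp _ _ _ (fun x : R => b * x) (fun z => expR (- z))).
    exact: gt0_cvgMry.
  exact: cvgr_expR.
- by move=> x _; have [] := dF x.
- by apply: cvg_at_right_filter; exact: cF.
- move=> x; rewrite in_itv/= andbT => x0; rewrite derive1E; have [_ ->] := dF x.
  by rewrite /peak subr0 gtr0_norm.
Qed.

Lemma integral_peak b y : 0 < b -> (\int[mu]_x (peak b y x)%:E = (2 / b)%:E)%E.
Proof.
move=> b0; rewrite -integral_peak0//.
have dF (x : R) : is_derive x (1 : R) (fun x : R => x - y) 1.
  by apply: is_derive_eq; rewrite subr0.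
have F'E : (fun x : R => x - y)^`()%classic = cst 1.
  by apply/funext => x; rewrite derive1E; have [_ ->] := dF x.
rewrite [RHS](@increasing_ge0_integration_by_substitutionT R (fun x : R => x - y)).
- by apply: eq_integral => x _; rewrite F'E /peak !fctE mulr1 subr0.
- by move=> u v uv; rewrite ltrD2r.
- by rewrite F'E; exact: cst_continuous.
- by rewrite F'E; exact: is_cvg_cst.
- by rewrite F'E; exact: is_cvg_cst.
- by move=> x; have [] := dF x.
- exact: cvg_addrr_Ny.
- exact: cvg_addrr.
- exact: peak_continuous.
- by move=> x; exact: peak_ge0.
Qed.

Lemma L2fun_peak a y : 0 < a -> L2fun (peak a y).
Proof.
move=> a0; split.
  by apply: continuous_measurable_fun; exact: peak_continuous.
under eq_integral do rewrite peak_sqr.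
by rewrite integral_peak ?mulrn_wgt0 ?ltry.
Qed.

Lemma L2norm2_peak a y : 0 < a -> L2norm2 (peak a y) = a^-1.
Proof.
move=> a0; rewrite /L2norm2; under eq_integral do rewrite peak_sqr.
by rewrite integral_peak ?mulrn_wgt0//=; field; rewrite gt_eqF.
Qed.

End Peak.

(** * The weak derivative of a peak *)

Section PeakH1.
Variable R : realType.
Local Notation mu := (@lebesgue_measure R).

(** Serves to cut at the corner [y] of a peak: on either side the peak is a smooth exponential, so
    integration by parts applies. *)
Lemma integral_split (f : R -> R) (b y c : R) : b < y < c ->
  measurable_fun setT f -> (forall x, (x < b) || (c < x) -> f x = 0) ->
  (\int[mu]_x (f x)%:E =
   \int[mu]_(x in `[b, y]) (f x)%:E + \int[mu]_(x in `[y, c]) (f x)%:E)%E.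
Proof.
move=> /andP[yb yc] mf f0.
have mfD D : measurable_fun D (EFin \o f) by apply/measurable_EFinP/measurable_funTS.
transitivity (\int[mu]_(x in `[b, c]) (f x)%:E)%E.
  rewrite [RHS]integral_mkcond; apply: eq_integral => x _.
  rewrite patchE; case: ifPn => //; rewrite notin_setE /= in_itv /= => /negP.
  by rewrite negb_and -!ltNge => /f0 ->.
rewrite -(@integral_itv_bndo_bndc _ _ y)//.
rewrite (_ : [set` `[b, c]] = [set` `[b, y[] `|` [set` `[y, c]]).
  rewrite integral_setU//; first exact: mfD.
  rewrite disj_set2E; apply/eqP/seteqP; split => // x [].
  by rewrite /= !in_itv /=; lra.
by rewrite -itv_bndbnd_setU// bnd_simp ltW.
Qed.

(** Lying outside a closed ball is an open condition, so the derivative vanishes there too. The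
    given radius may be negative, hence [|M| + 1]. *)
Lemma test_fun_vanish (phi : R -> R) : test_fun phi -> exists2 M, 0 < M &
  forall x, M < `|x| -> phi x = 0 /\ phi^`()%classic x = 0.
Proof.
move=> [dphi [M phi0]]; exists (`|M| + 1) => [|x Mx].
  by rewrite ltr_wpDl.
have MM : M < `|M| + 1 by rewrite (le_lt_trans (ler_norm M))// ltrDl.
split; first by rewrite phi0// (lt_trans MM).
rewrite derive1E (@near_eq_derive _ R R _ (cst (0 : R))) ?derive_cst//.
near=> z; apply: phi0; near: z.
have : `|z| @[z --> x] --> `|x| by exact: norm_continuous.
move=> /cvgr_gt; apply; exact: lt_trans Mx.
Unshelve. all: by end_near. Qed.

Lemma test_fun_continuous (phi : R -> R) : test_fun phi ->
  [/\ forall x, derivable phi x (1 : R), continuous phi & continuous phi^`()%classic].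
Proof.
move=> [dphi _]; split.
- exact: dphi 0%N.
- by move=> x; apply/differentiable_continuous/derivable1_diffP; exact: dphi 0%N x.
- by move=> x; apply/differentiable_continuous/derivable1_diffP; exact: dphi 1%N x.
Qed.

(** The value [- a] at the corner is a choice on a null set; with it the square is a^2 p^2 at every
    point. *)
Definition peak_deriv (a y x : R) : R :=
  if x < y then a * peak a y x else - a * peak a y x.

Lemma measurable_peak_deriv a y : measurable_fun setT (peak_deriv a y).
Proof.
have mp : measurable_fun setT (peak a y).
  by apply: continuous_measurable_fun; exact: peak_continuous.
apply: measurable_fun_ifT; [exact: measurable_fun_ltr|exact: measurable_funM|].
exact: measurable_funM.
Qed.

Lemma peak_deriv_sqr a y x : peak_deriv a y x ^+ 2 = a ^+ 2 * peak a y x ^+ 2.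
Proof. by rewrite /peak_deriv; case: ifP => _; rewrite exprMn ?sqrrN. Qed.

(** The rate [k] is free because it is [a] to the left of the corner and [- a] to its right. *)
Lemma integration_by_parts_exp (phi : R -> R) (k y b c : R) : b < c ->
  test_fun phi ->
  (\int[mu]_(x in `[b, c]) (expR (k * (x - y)) * phi^`()%classic x)%:E =
   (expR (k * (c - y)) * phi c - expR (k * (b - y)) * phi b)%:E
   - \int[mu]_(x in `[b, c]) (k * expR (k * (x - y)) * phi x)%:E)%E.
Proof.
move=> bc /test_fun_continuous[dphi cphi cphi'].
have dF (x : R) : is_derive x (1 : R) (fun x : R => expR (k * (x - y)))
    (k * expR (k * (x - y))).
  have dl : is_derive x (1 : R) (fun x : R => k * (x - y)) k.
    by apply: is_derive_eq; rewrite subr0 /GRing.scale/= mulr1.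
  rewrite mulrC; exact: (@is_derive1_comp R expR _ x _ _ (is_derive_expR _) dl).
have cF : continuous (fun x : R => expR (k * (x - y))).
  by move=> x; apply/differentiable_continuous/derivable1_diffP; have [] := dF x.
have ckF : continuous (fun x : R => k * expR (k * (x - y))).
  by move=> x; apply: cvgM; [exact: cvg_cst|exact: cF].
apply: (@integration_by_parts R (fun x => expR (k * (x - y))) phi) => //.
- exact: continuous_subspaceT ckF.
- split; first by move=> x _; have [] := dF x.
  + by apply: cvg_at_right_filter; exact: cF.
  + by apply: cvg_at_left_filter; exact: cF.
- by move=> x _; rewrite derive1E; have [_ ->] := dF x.
- exact: continuous_subspaceT.
- split => //.
  + by apply: cvg_at_right_filter; exact: cphi.
  + by apply: cvg_at_left_filter; exact: cphi.
Qed.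

(** Integration by parts on each side of [y] leaves the boundary terms phi(y) and - phi(y), which
    cancel because the peak is continuous at its corner. *)
Lemma weak_deriv_peak a y : weak_deriv (peak a y) (peak_deriv a y).
Proof.
move=> phi tphi; have [dphi cphi cphi'] := test_fun_continuous tphi.
have [M M0 phi0] := test_fun_vanish tphi.
(* Large enough that both [y - L] and [y + L] lie outside the ball of radius [M], where [phi]
   vanishes. *)
pose L := M + `|y| + 1.
have L0 : 0 < L by rewrite /L; have := normr_ge0 y; lra.
have outE x : (x < y - L) || (y + L < x) -> M < `|x|.
  rewrite /L; have := ler_norm y; have := ler_norm (- y); rewrite normrN.
  have := ler_norm x; have := ler_norm (- x); rewrite normrN.
  by move=> ? ? ? ? /orP[]; lra.
have yL : y - L < y < y + L by lra.
have phiE : phi (y - L) = 0 /\ phi (y + L) = 0.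
  rewrite /L; have := ler_norm y; have := ler_norm (- y); rewrite normrN => ? ?.
  split; apply: (phi0 _ _).1.
    have := ler_norm (- (y - (M + `|y| + 1))); rewrite normrN; lra.
  have := ler_norm (y + (M + `|y| + 1)); lra.
have mp : measurable_fun setT (peak a y).
  by apply: continuous_measurable_fun; exact: peak_continuous.
rewrite (integral_split yL); last 2 first.
- by apply: measurable_funM => //; apply: continuous_measurable_fun.
- by move=> x /outE /phi0[_ ->]; rewrite mulr0.
rewrite [X in _ = (- X)%E](integral_split yL); last 2 first.
- by apply: measurable_funM; [exact: measurable_peak_deriv|apply: continuous_measurable_fun].
- by move=> x /outE /phi0[-> _]; rewrite mulr0.
have peakl x : x <= y -> peak a y x = expR (a * (x - y)).
  by move=> xy; rewrite /peak ler0_norm ?subr_le0// mulrN opprK.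
have peakr x : y <= x -> peak a y x = expR (- a * (x - y)).
  by move=> xy; rewrite /peak ger0_norm ?subr_ge0// mulNr.
(* The endpoint [y] is removed from the left interval because [peak_deriv] takes its right branch
   there. *)
rewrite -[in X in (_ = - (X + _))%E](@integral_itv_bndo_bndc _ _ y); last first.
  apply/measurable_EFinP/measurable_funTS/measurable_funM.
    exact: measurable_peak_deriv.
  exact: continuous_measurable_fun.
have [yL1 yL2] := andP yL.
have l1 : (\int[mu]_(x in `[(y - L)%R, y]) (peak a y x * phi^`()%classic x)%:E =
  (phi y)%:E - \int[mu]_(x in `[(y - L)%R, y]) (a * expR (a * (x - y)) * phi x)%:E)%E.
  have := integration_by_parts_exp a y yL1 tphi.
  rewrite phiE.1 mulr0 subr0 subrr mulr0 expR0 mul1r => <-.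
  by apply: eq_integral => x; rewrite inE /= in_itv /= => /andP[_ ?]; rewrite peakl.
have l2 : (\int[mu]_(x in `[y, (y + L)%R]) (peak a y x * phi^`()%classic x)%:E =
  - (phi y)%:E
   - \int[mu]_(x in `[y, (y + L)%R]) (- a * expR (- a * (x - y)) * phi x)%:E)%E.
  have := integration_by_parts_exp (- a) y yL2 tphi.
  rewrite phiE.2 mulr0 sub0r subrr mulr0 expR0 mul1r EFinN => <-.
  by apply: eq_integral => x; rewrite inE /= in_itv /= => /andP[? _]; rewrite peakr.
have r1 : (\int[mu]_(x in `[(y - L)%R, y[) (peak_deriv a y x * phi x)%:E =
  \int[mu]_(x in `[(y - L)%R, y]) (a * expR (a * (x - y)) * phi x)%:E)%E.
  have cexp : continuous (fun x => a * expR (a * (x - y)) * phi x).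
    move=> x; apply: cvgM; last exact: cphi.
    apply: cvgM; first exact: cvg_cst.
    apply: continuous_comp; last exact: continuous_expR.
    apply: continuousM; first exact: cst_continuous.
    by apply: continuousB; [exact: cvg_id|exact: cst_continuous].
  rewrite -[RHS]integral_itv_bndo_bndc; last first.
    by apply/measurable_EFinP/measurable_funTS; exact: continuous_measurable_fun.
  apply: eq_integral => x; rewrite inE /= in_itv /= => /andP[_ xy].
  by rewrite /peak_deriv xy peakl// ltW.
have r2 : (\int[mu]_(x in `[y, (y + L)%R]) (peak_deriv a y x * phi x)%:E =
  \int[mu]_(x in `[y, (y + L)%R]) (- a * expR (- a * (x - y)) * phi x)%:E)%E.
  apply: eq_integral => x; rewrite inE /= in_itv /= => /andP[xy _].
  by rewrite /peak_deriv ltNge xy/= peakr.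
(* Finiteness of the two integrals turns the identity in the extended reals into one between
   reals. *)
have fin k z b c : (\int[mu]_(x in `[b, c]) (k * expR (k * (x - z)) * phi x)%:E
    \is a fin_num)%E.
  apply: integrable_fin_num => //; apply: continuous_compact_integrable.
    exact: segment_compact.
  apply: continuous_subspaceT => x; apply: cvgM; last exact: cphi.
  apply: cvgM; first exact: cvg_cst.
  apply: continuous_comp; last exact: continuous_expR.
  apply: continuousM; first exact: cst_continuous.
  by apply: continuousB; [exact: cvg_id|exact: cst_continuous].
rewrite l1 l2 r1 r2 -(fineK (fin a y (y - L) y)) -(fineK (fin (- a) y y (y + L))).
set A := fine _; set B := fine _; rewrite /=; congr EFin; ring.
Qed.

Lemma H1_peak a y : 0 < a -> H1_with_deriv (peak a y) (peak_deriv a y).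
Proof.
move=> a0; split; first exact: peak_continuous.
have Lp := L2fun_peak y a0; split => //; split; last exact: weak_deriv_peak.
apply: L2fun_le (L2funZ a Lp); first exact: measurable_peak_deriv.
by move=> x; rewrite /peak_deriv; case: ifP => _; rewrite ?mulNr ?normrN.
Qed.

Lemma L2norm2_peak_deriv a y : 0 < a -> L2norm2 (peak_deriv a y) = a.
Proof.
move=> a0; rewrite /L2norm2; under eq_integral do rewrite peak_deriv_sqr EFinM.
rewrite integralZl//; last exact/L2fun_integrable_sqr/L2fun_peak.
rewrite (L2norm2E (L2fun_peak y a0)) L2norm2_peak//= expr2 -mulrA divff ?mulr1//.
by rewrite gt_eqF.
Qed.

End PeakH1.

(** * Truncated peaks as test functions *)

Section TestFunctions.
Variable R : realType.
Local Notation mu := (@lebesgue_measure R).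
Implicit Types (u g : R -> R) (a y t z x : R).

(* For 1 <= t this is a smooth step between 0 and 1 / t, followed by a descent
   between t and 2 t whose slope is at most of order 1 / t. *)
Definition cutoff t z := smooth_step (t * z) + smooth_step (2 + - t^-1 * z) - 1.

(** A test function standing for sgn(x - y) p, that is, for - p' / a. Its companion [even_peak]
    stands for p itself. *)
Definition odd_peak a y t x :=
  (cutoff t (x - y) - cutoff t (y - x)) * peak a y x.

Definition even_peak a y t x :=
  (cutoff t (x - y) + cutoff t (y - x)) * peak a y x.

Lemma cutoff_le0 t z : 1 <= t -> z <= 0 -> cutoff t z = 0.
Proof.
move=> t1 z0; have t0 : 0 < t by exact: lt_le_trans t1.
rewrite /cutoff smooth_step_le0 ?pmulr_rle0// smooth_step_ge1 ?add0r ?subrr//.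
have : 0 <= - t^-1 * z by rewrite mulNr -mulrN mulr_ge0 ?invr_ge0 ?oppr_ge0// ltW.
lra.
Qed.

Lemma cutoff_support t z : 1 <= t -> 2 * t <= z -> cutoff t z = 0.
Proof.
move=> t1 tz; have t0 : 0 < t by exact: lt_le_trans t1.
rewrite /cutoff smooth_step_ge1 ?smooth_step_le0 ?addr0 ?subrr//.
  by rewrite mulNr subr_le0 mulrC ler_pdivlMr.
nra.
Qed.

(** At every point one of the two steps equals 1, so that [cutoff] coincides with the other one. *)
Lemma cutoff_itv t z : 1 <= t -> 0 <= cutoff t z <= 1.
Proof.
move=> t1; have t0 : 0 < t by exact: lt_le_trans t1.
rewrite /cutoff; have [tz|tz] := leP 1 (t * z).
  rewrite (smooth_step_ge1 tz) addrAC subrr add0r.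
  by rewrite smooth_step_ge0 smooth_step_le1.
rewrite (@smooth_step_ge1 _ (2 + _)); first by rewrite addrK smooth_step_ge0 smooth_step_le1.
have : t^-1 * z <= 1.
  have z1 : z <= 1.
    rewrite leNgt; apply/negP => z1; move: tz; rewrite ltNge => /negP; apply.
    by rewrite mulr_ege1// ltW.
  by rewrite mulrC ler_pdivrMr// mul1r (le_trans z1).
by rewrite mulNr; lra.
Qed.

Lemma elementary_opp (f : R -> R) : elementary f -> elementary (fun x => - f x).
Proof.
move=> ef; rewrite (_ : (fun x => _) = fun x => -1 * f x).
  by apply: elementary_mul => //; constructor.
by apply/funext => x; rewrite mulN1r.
Qed.

Lemma elementary_cutoff t (f : R -> R) : elementary f ->
  elementary (fun x => cutoff t (f x)).
Proof.
move=> ef; apply: elementary_add; last by constructor.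
have em c : elementary (fun x => c * f x) by apply: elementary_mul => //; constructor.
apply: elementary_add; apply: elementary_comp => //; try exact: elementary_smooth_step.
by apply: elementary_add => //; constructor.
Qed.

Lemma elementary_sub y : elementary (fun x => x - y) /\ elementary (fun x => y - x).
Proof.
split; first by apply: elementary_add; constructor.
by apply: elementary_add; [constructor|apply: elementary_opp; constructor].
Qed.

Lemma peakl a y x : x <= y -> peak a y x = expR (- (a * (y - x))).
Proof. by move=> xy; rewrite /peak distrC ger0_norm ?subr_ge0. Qed.

Lemma peakr a y x : y <= x -> peak a y x = expR (- (a * (x - y))).
Proof. by move=> xy; rewrite /peak ger0_norm ?subr_ge0. Qed.

(** Each cutoff vanishes on the side where its exponential differs from the peak. The absolute value
    in the peak thus disappears, and smoothness becomes visible. *)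
Lemma odd_peakE a y t : 1 <= t -> odd_peak a y t =
  (fun x => cutoff t (x - y) * expR (- (a * (x - y)))
            - cutoff t (y - x) * expR (- (a * (y - x)))).
Proof.
move=> t1; apply/funext => x; rewrite /odd_peak; have [xy|xy] := leP x y.
  by rewrite (@cutoff_le0 _ (x - y)) ?subr_le0// peakl//; ring.
by rewrite (@cutoff_le0 _ (y - x)) ?subr_le0 ?(ltW xy)// peakr ?(ltW xy)//; ring.
Qed.

(** The two cutoffs are never nonzero at the same point, so the sign between them is lost on
    squaring. *)
Lemma even_peak_sqr a y t x : 1 <= t ->
  even_peak a y t x ^+ 2 = odd_peak a y t x ^+ 2.
Proof.
move=> t1; rewrite /even_peak /odd_peak; have [xy|xy] := leP x y.
  by rewrite (@cutoff_le0 _ (x - y)) ?subr_le0//; ring.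
by rewrite (@cutoff_le0 _ (y - x)) ?subr_le0 ?(ltW xy)//; ring.
Qed.

Lemma even_peak_itv a y t x : 1 <= t -> 0 <= even_peak a y t x <= peak a y x.
Proof.
move=> t1; rewrite /even_peak.
have /andP[l1 l2] := cutoff_itv (x - y) t1; have /andP[r1 r2] := cutoff_itv (y - x) t1.
apply/andP; split; first by apply: mulr_ge0; [exact: addr_ge0|exact: peak_ge0].
rewrite ler_piMl ?peak_ge0//.
have [xy|xy] := leP x y.
  by rewrite (@cutoff_le0 _ (x - y)) ?subr_le0// add0r.
by rewrite (@cutoff_le0 _ (y - x)) ?subr_le0 ?(ltW xy)// addr0.
Qed.

Lemma elementary_odd_peak a y t : 1 <= t -> elementary (odd_peak a y t).
Proof.
move=> t1; rewrite odd_peakE//; have [e1 e2] := elementary_sub y.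
have eexp (f : R -> R) : elementary f -> elementary (fun x => expR (- (a * f x))).
  move=> ef; apply: elementary_comp; first by constructor.
  by apply: elementary_opp; apply: elementary_mul => //; constructor.
apply: elementary_add; [|apply: elementary_opp]; apply: elementary_mul;
  by [exact: elementary_cutoff|exact: eexp].
Qed.

Lemma test_fun_odd_peak a y t : 1 <= t -> test_fun (odd_peak a y t).
Proof.
move=> t1; split; first exact/elementary_smooth/elementary_odd_peak.
exists (2 * t + `|y|) => x xt.
have tz : 2 * t <= `|x - y| by have := lerB_dist x y; lra.
rewrite /odd_peak; have [xy|xy] := leP x y.
  rewrite (@cutoff_le0 _ (x - y)) ?subr_le0// cutoff_support ?subrr ?mul0r//.
  by rewrite ler0_norm ?opprB ?subr_le0 in tz.
rewrite (@cutoff_le0 _ (y - x)) ?subr_le0 ?(ltW xy)// cutoff_support ?subrr ?mul0r//.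
by rewrite ger0_norm ?subr_ge0 ?(ltW xy) in tz.
Qed.

Definition cutoff_deriv (s : R -> R) t z := t * s (t * z) - t^-1 * s (2 + - t^-1 * z).

(** In the product rule the exponentials yield the term with [even_peak] and the cutoffs yield the
    rest. The inner derivative -1 of [y - x] turns the difference into a sum. *)
Lemma odd_peak_deriv (s : R -> R) a y t x : 1 <= t ->
  (forall x, is_derive x (1 : R) (@smooth_step R) (s x)) ->
  (forall x, x < 0 -> s x = 0) -> (forall x, 1 < x -> s x = 0) ->
  derive1 (odd_peak a y t) x = - a * even_peak a y t x
    + peak a y x * (cutoff_deriv s t (x - y) + cutoff_deriv s t (y - x)).
Proof.
move=> t1 ds s0 s1; rewrite odd_peakE// derive1E.
have t0 : 0 < t by exact: lt_le_trans t1.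
have ti0 : 0 < t^-1 by rewrite invr_gt0.
have dl (b c : R) : is_derive x (1 : R) (fun x : R => b + c * x) c.
  by apply: is_derive_eq; rewrite /GRing.scale/=; ring.
(* The affine argument [b + k * x] treats both halves at once, with [k] equal to 1 and to -1. *)
have dchi (k b : R) : is_derive x (1 : R)
   (fun x : R => cutoff t (b + k * x) * expR (- (a * (b + k * x))))
   (k * cutoff_deriv s t (b + k * x) * expR (- (a * (b + k * x)))
    - k * a * cutoff t (b + k * x) * expR (- (a * (b + k * x)))).
  have d1 := @is_derive1_comp R (@smooth_step R)
    (fun x => t * b + (t * k) * x) x _ _ (ds _) (dl _ _).
  have d2 := @is_derive1_comp R (@smooth_step R)
    (fun x => (2 + - t^-1 * b) + (- t^-1 * k) * x) x _ _ (ds _) (dl _ _).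
  have d3 := @is_derive1_comp R expR
    (fun x => (- (a * b)) + (- (a * k)) * x) x _ _ (is_derive_expR _) (dl _ _).
  have d4 := is_deriveM (is_deriveB (is_deriveD d1 d2) (is_derive_cst (1 : R) x 1)) d3.
  have E1 (z : R) : t * b + t * k * z = t * (b + k * z) by ring.
  have E2 (z : R) : 2 + - t^-1 * b + - t^-1 * k * z = 2 + - t^-1 * (b + k * z) by ring.
  have E3 (z : R) : - (a * b) + - (a * k) * z = - (a * (b + k * z)) by ring.
  rewrite (_ : (fun x => _) = ((smooth_step (R:=R) \o (fun x : R => t * b + t * k * x)) +
          (smooth_step (R:=R) \o (fun x : R => 2 + - t^-1 * b + - t^-1 * k * x)) -
          cst 1) * (expR \o (fun x : R => - (a * b) + - (a * k) * x))); last first.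
    by apply/funext => z; rewrite !fctE /= E1 E2 E3.
  apply: is_derive_eq d4 _.
  rewrite !fctE /= E1 E2 E3 /cutoff_deriv /cutoff /GRing.scale/=; ring.
have e1 (z : R) : z - y = - y + 1 * z by ring.
have e2 (z : R) : y - z = y + - 1 * z by ring.
have -> : (fun x : R => cutoff t (x - y) * expR (- (a * (x - y)))
            - cutoff t (y - x) * expR (- (a * (y - x)))) =
  (fun x => cutoff t (- y + 1 * x) * expR (- (a * (- y + 1 * x)))) -
  (fun x => cutoff t (y + - 1 * x) * expR (- (a * (y + - 1 * x)))).
  by apply/funext => z; rewrite !fctE /= -!e1 -!e2.
have [_ ->] := is_deriveB (dchi 1 (- y)) (dchi (- 1) y).
rewrite -!e1 -!e2 /even_peak.
have cd0 z : z < 0 -> cutoff_deriv s t z = 0.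
  move=> z0; rewrite /cutoff_deriv s0 ?pmulr_rlt0// s1 ?mulr0 ?subrr//.
  have : 0 < - t^-1 * z by rewrite mulNr -mulrN mulr_gt0// oppr_gt0.
  by lra.
(* Away from [y] one cutoff and its derivative vanish, and the other exponential is the peak; at [y]
   all exponentials are 1. *)
have [xy|xy|<-] := ltgtP x y.
- rewrite (@cutoff_le0 _ (x - y)) ?subr_le0 ?(ltW xy)// peakl ?(ltW xy)// (cd0 (x - y)) ?subr_lt0//.
  ring.
- rewrite (@cutoff_le0 _ (y - x)) ?subr_le0 ?(ltW xy)// peakr ?(ltW xy)// (cd0 (y - x)) ?subr_lt0//.
  ring.
- rewrite peak_center subrr mulr0 oppr0 expR0; ring.
Qed.

End TestFunctions.

(** * The sharp pointwise bound *)

Section LowerBound.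
Variable R : realType.
Local Notation mu := (@lebesgue_measure R).
Implicit Types (f g u : R -> R) (a c y t x : R).

Definition integrableR f := mu.-integrable setT (EFin \o f).

Lemma integrableR_add f g :
  integrableR f -> integrableR g -> integrableR (fun x => f x + g x).
Proof.
move=> fi gi; have := integrableD measurableT fi gi.
by apply: eq_integrable.
Qed.

Lemma integrableR_scale c f : integrableR f -> integrableR (fun x => c * f x).
Proof.
by move=> fi; have := integrableZl measurableT c fi; apply: eq_integrable.
Qed.

Lemma L2norm2_Rintegral f : L2norm2 f = \int[mu]_x (f x ^+ 2).
Proof. by []. Qed.

(** The part of the derivative of [odd_peak] carried by the cutoffs. As [t] grows it approximates
    twice the point mass at [y], one unit from each side. *)
Definition mollifier (s : R -> R) a y t x :=
  peak a y x * (cutoff_deriv s t (x - y) + cutoff_deriv s t (y - x)).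

Section Bound.
Variables (s : R -> R) (K : R).
Hypothesis es : elementary s.
Hypothesis ds : forall x, is_derive x (1 : R) (@smooth_step R) (s x).
Hypothesis s0 : forall x, x < 0 -> s x = 0.
Hypothesis s1 : forall x, 1 < x -> s x = 0.
Hypothesis K0 : 0 <= K.
Hypothesis sK : forall x, `|s x| <= K.

Let continuous_affine (f : R -> R) (b c : R) :
  continuous f -> continuous (fun x => f (b + c * x)).
Proof.
move=> cf x; apply: (@continuous_comp _ _ _ (fun x => b + c * x) f); last exact: cf.
apply: cvgD; first exact: cvg_cst.
by apply: cvgM; [exact: cvg_cst|exact: cvg_id].
Qed.

Let continuous_sub (f : R -> R) y :
  continuous f -> continuous (fun x => f (x - y)) /\ continuous (fun x => f (y - x)).
Proof.
move=> cf; split.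
  rewrite (_ : (fun x => _) = fun x => f (- y + 1 * x)); first exact: continuous_affine.
  by apply/funext => x; congr f; ring.
rewrite (_ : (fun x => _) = fun x => f (y + - 1 * x)); first exact: continuous_affine.
by apply/funext => x; congr f; ring.
Qed.

Let cs : continuous s. Proof. exact: elementary_continuous. Qed.

Let continuous_cutoff t : continuous (cutoff t).
Proof. exact: elementary_continuous (elementary_cutoff t (elementary_id R)). Qed.

Let continuous_scale t : continuous (fun z => s (t * z)).
Proof.
rewrite (_ : (fun z => _) = fun z => s (0 + t * z)); first exact: continuous_affine.
by apply/funext => z; rewrite add0r.
Qed.

Let continuous_cutoff_deriv t : continuous (cutoff_deriv s t).
Proof.
have c1 := @continuous_scale t.
have c2 := @continuous_affine s 2 (- t^-1) cs.
by move=> x; apply: cvgB; apply: cvgM; [exact: cvg_cst|exact: c1|exact: cvg_cst|exact: c2].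
Qed.

Let continuous_mollifier a y t : continuous (mollifier s a y t).
Proof.
move=> x; apply: cvgM; first exact: peak_continuous.
have [c1 c2] := continuous_sub y (@continuous_cutoff_deriv t).
by apply: cvgD; [exact: c1|exact: c2].
Qed.

Let continuous_even_peak a y t : continuous (even_peak a y t).
Proof.
move=> x; apply: cvgM; last exact: peak_continuous.
have [c1 c2] := continuous_sub y (@continuous_cutoff t).
by apply: cvgD; [exact: c1|exact: c2].
Qed.

Let L2fun_even_peak a y t : 0 < a -> 1 <= t -> L2fun (even_peak a y t).
Proof.
move=> a0 t1; apply: L2fun_le (L2fun_peak y a0).
  by apply: continuous_measurable_fun; exact: continuous_even_peak.
move=> x; have /andP[e0 e1] := even_peak_itv a y x t1.
by rewrite !ger0_norm// (le_trans e0).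
Qed.

Let L2fun_odd_peak a y t : 0 < a -> 1 <= t -> L2fun (odd_peak a y t).
Proof.
move=> a0 t1; apply: L2fun_le (L2fun_even_peak y a0 t1).
  by apply: continuous_measurable_fun; apply: elementary_continuous;
    exact: elementary_odd_peak.
move=> x; rewrite -ler_sqr ?nnegrE// !real_normK ?num_real//.
by rewrite even_peak_sqr.
Qed.

Let cutoff_deriv_le t z : 1 <= t -> `|cutoff_deriv s t z| <= (t + t^-1) * K.
Proof.
move=> t1; have t0 : 0 < t by exact: lt_le_trans t1.
rewrite (le_trans (ler_normB _ _))// mulrDl lerD// normrM ler_pM//.
  by rewrite gtr0_norm.
by rewrite gtr0_norm// invr_gt0.
Qed.

Let L2fun_mollifier a y t : 0 < a -> 1 <= t -> L2fun (mollifier s a y t).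
Proof.
move=> a0 t1; apply: L2fun_le (L2funZ (2 * ((t + t^-1) * K)) (L2fun_peak y a0)).
  by apply: continuous_measurable_fun; exact: continuous_mollifier.
move=> x; rewrite /mollifier mulrC !normrM ler_wpM2r//.
rewrite (le_trans (ler_normD _ _))//.
rewrite (le_trans (lerD (cutoff_deriv_le _ t1) (cutoff_deriv_le _ t1)))//.
by rewrite -!normrM (le_trans _ (ler_norm _))// mulr_natl mulr2n.
Qed.

(* Integrate |a u - c a P|^2 + |g + c a Q|^2 >= 0, with P and Q the even and odd
   truncated peaks: P^2 = Q^2 is at most the squared peak, and the cross term is
   evaluated by testing the weak derivative with Q. *)
Lemma test_inequality u g a c y t : 0 < a -> 1 <= t -> H1_with_deriv u g ->
  2 * c * a * (\int[mu]_x (u x * mollifier s a y t x)) <=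
  L2norm2 g + a ^+ 2 * L2norm2 u + 2 * c ^+ 2 * a.
Proof.
move=> a0 t1 H; have [cu [Lu [Lg wd]]] := H.
have dQ : derive1 (odd_peak a y t) =
    (fun x => - a * even_peak a y t x + mollifier s a y t x).
  by apply/funext => x; exact: odd_peak_deriv.
have iuD : integrableR (fun x => u x * mollifier s a y t x).
  by apply: L2fun_integrableM => //; exact: L2fun_mollifier.
have iuP : integrableR (fun x => u x * even_peak a y t x).
  by apply: L2fun_integrableM => //; exact: L2fun_even_peak.
have igQ : integrableR (fun x => g x * odd_peak a y t x).
  by apply: L2fun_integrableM => //; exact: L2fun_odd_peak.
(* This is the definition of the weak derivative tested with Q, where Q' = - a P + [mollifier]. *)
have weak : (\int[mu]_x (u x * mollifier s a y t x)) =
    a * (\int[mu]_x (u x * even_peak a y t x)) - (\int[mu]_x (g x * odd_peak a y t x)).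
  have -> : - (\int[mu]_x (g x * odd_peak a y t x)) =
     \int[mu]_x (u x * derive1 (odd_peak a y t) x).
    by rewrite /Rintegral (wd _ (test_fun_odd_peak a y t1)) fineN.
  rewrite dQ -RintegralZl//.
  rewrite -RintegralD//; [|exact: integrableR_scale|].
    by apply: eq_Rintegral => x _; ring.
  rewrite (_ : EFin \o _ = EFin \o (fun x => - a * (u x * even_peak a y t x)
     + u x * mollifier s a y t x)).
    by apply: integrableR_add => //; exact: integrableR_scale.
  by apply/funext => x; rewrite /=; congr EFin; ring.
have ig2 : integrableR (fun x => g x ^+ 2) by exact: L2fun_integrable_sqr.
have iu2 : integrableR (fun x => u x ^+ 2) by exact: L2fun_integrable_sqr.
have ip2 : integrableR (fun x => peak a y x ^+ 2).
  by apply: L2fun_integrable_sqr; exact: L2fun_peak.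
(* As the squared norm of the peak is 1/a, the last term is also an integral, and the claim reduces
   to a pointwise inequality. *)
have -> : 2 * c ^+ 2 * a = 2 * c ^+ 2 * a ^+ 2 * L2norm2 (peak a y).
  by rewrite L2norm2_peak//; field; rewrite gt_eqF.
rewrite weak !L2norm2_Rintegral -!RintegralZl// -RintegralD//; last exact: integrableR_scale.
rewrite -RintegralD//; last exact: integrableR_scale; last first.
  exact: integrableR_add ig2 (integrableR_scale _ iu2).
rewrite -RintegralB//; last exact: integrableR_scale.
rewrite -RintegralZl//; last first.
  have := integrableR_add (integrableR_scale a iuP) (integrableR_scale (-1) igQ).
  by apply: eq_integrable => // x _; rewrite /= mulN1r.
apply: le_Rintegral => //.
- have := integrableR_scale (2 * c * a)
    (integrableR_add (integrableR_scale a iuP) (integrableR_scale (-1) igQ)).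
  by apply: eq_integrable => // x _; rewrite /= mulN1r.
- exact: integrableR_add (integrableR_add ig2 (integrableR_scale _ iu2)) (integrableR_scale _ ip2).
move=> x _; have /andP[e0 e1] := even_peak_itv a y x t1.
have esq : even_peak a y t x ^+ 2 <= peak a y x ^+ 2 by rewrite lerXn2r ?nnegrE// peak_ge0.
have h1 := sqr_ge0 (a * u x - c * a * even_peak a y t x).
have h2 := sqr_ge0 (g x + c * a * odd_peak a y t x).
have h3 : c ^+ 2 * a ^+ 2 * even_peak a y t x ^+ 2 <= c ^+ 2 * a ^+ 2 * peak a y x ^+ 2.
  by rewrite ler_wpM2l// mulr_ge0 ?sqr_ge0.
have h4 : c ^+ 2 * a ^+ 2 * even_peak a y t x ^+ 2 =
  c ^+ 2 * a ^+ 2 * odd_peak a y t x ^+ 2 by rewrite even_peak_sqr.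
nra.
Qed.

(** The slopes of the cutoffs are separated: the ascent lives within 1/t of [y] and has total mass
    2, while the descent ([far_part]) lives between distances t and 2 t and has size of order
    1/t. *)
Let near_part t y x := t * s (t * (x - y)) + t * s (t * (y - x)).

Let far_part t y x :=
  - (t^-1 * (s (2 + - t^-1 * (x - y)) + s (2 + - t^-1 * (y - x)))).

Let mollifierE a y t x :
  mollifier s a y t x = peak a y x * near_part t y x + peak a y x * far_part t y x.
Proof. by rewrite /mollifier /cutoff_deriv /near_part /far_part; ring. Qed.

Let continuous_near_part t y : continuous (near_part t y).
Proof.
have [c1 c2] := continuous_sub y (@continuous_scale t).
by move=> x; apply: cvgD; apply: cvgM; [exact: cvg_cst|exact: c1|exact: cvg_cst|exact: c2].
Qed.

Let continuous_far_part t y : continuous (far_part t y).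
Proof.
have [c1 c2] := continuous_sub y (@continuous_affine s 2 (- t^-1) cs).
move=> x; apply: cvgN; apply: cvgM; first exact: cvg_cst.
by apply: cvgD; [exact: c1|exact: c2].
Qed.

Let near_part_le t y x : 0 < t -> `|near_part t y x| <= 2 * t * K.
Proof.
move=> t0; rewrite (le_trans (ler_normD _ _))// -mulrA mulr_natl mulr2n.
by apply: lerD; rewrite normrM gtr0_norm// ler_wpM2l// ltW.
Qed.

Let far_part_le t y x : 0 < t -> `|far_part t y x| <= 2 * K / t.
Proof.
move=> t0; rewrite normrN normrM gtr0_norm ?invr_gt0// mulrC ler_pM2r ?invr_gt0//.
by rewrite (le_trans (ler_normD _ _))// mulr_natl mulr2n lerD.
Qed.

Let L2fun_peakM a y b (f : R -> R) : 0 < a -> continuous f -> (forall x, `|f x| <= b) ->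
  L2fun (fun x => peak a y x * f x).
Proof.
move=> a0 cf fb; apply: L2fun_le (L2funZ b (L2fun_peak y a0)).
  apply: measurable_funM; apply: continuous_measurable_fun => //.
  exact: peak_continuous.
by move=> x; rewrite mulrC !normrM ler_wpM2r// (le_trans (fb x))// ler_norm.
Qed.

(** Pointwise the far part is at most 2 K / t and |u p| is at most u^2 + p^2, where p^2 has integral
    1/a. The contribution therefore vanishes as [t] grows. *)
Lemma far_part_integral u a y t : 0 < a -> 0 < t -> L2fun u ->
  `|\int[mu]_x (u x * (peak a y x * far_part t y x))| <=
  2 * K / t * (L2norm2 u + a^-1).
Proof.
move=> a0 t0 Lu.
have Lf : L2fun (fun x => peak a y x * far_part t y x).
  by apply: (L2fun_peakM y a0 (@continuous_far_part t y)) => x; exact: far_part_le.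
have iu := L2fun_integrableM Lu Lf.
have ib : integrableR (fun x => u x ^+ 2 + peak a y x ^+ 2).
  by apply: integrableR_add; apply: L2fun_integrable_sqr => //; exact: L2fun_peak.
apply: (le_trans (le_normr_Rintegral measurableT iu)).
rewrite -(L2norm2_peak y a0) !L2norm2_Rintegral -RintegralD//; last 2 first.
- exact: L2fun_integrable_sqr.
- by apply: L2fun_integrable_sqr; exact: L2fun_peak.
rewrite -RintegralZl//; apply: le_Rintegral => //.
- exact: integrable_norm iu.
- exact: integrableR_scale.
move=> x _; rewrite mulrA normrM mulrC ler_pM ?far_part_le//.
rewrite normrM -(real_normK (num_real (u x))) -(real_normK (num_real (peak a y x))).
have := sqr_ge0 (`|u x| - `|peak a y x|); rewrite sqrrB.
by have := mulr_ge0 (normr_ge0 (u x)) (normr_ge0 (peak a y x)); lra.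
Qed.

(** The primitive [F] increases from -1 at the left endpoint to 1 at the right one. *)
Let near_part_integral t y : 1 <= t ->
  (\int[mu]_(x in `[y - t^-1, y + t^-1]) near_part t y x) = 2.
Proof.
move=> t1; have t0 : 0 < t by exact: lt_le_trans t1.
have ti0 : 0 < t^-1 by rewrite invr_gt0.
have dl (b c x : R) : is_derive x (1 : R) (fun x : R => b + c * x) c.
  by apply: is_derive_eq; rewrite /GRing.scale/=; ring.
pose F x := smooth_step (- (t * y) + t * x) - smooth_step (t * y + - t * x).
have E1 z : - (t * y) + t * z = t * (z - y) by ring.
have E2 z : t * y + - t * z = t * (y - z) by ring.
have dF x : is_derive x (1 : R) F (near_part t y x).
  have d1 := @is_derive1_comp R (@smooth_step R) _ x _ _ (ds _) (dl (- (t * y)) t x).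
  have d2 := @is_derive1_comp R (@smooth_step R) _ x _ _ (ds _) (dl (t * y) (- t) x).
  apply: is_derive_eq (is_deriveB d1 d2) _.
  by rewrite E1 E2 /near_part; ring.
have cF : continuous F.
  by move=> x; apply/differentiable_continuous/derivable1_diffP; have [] := dF x.
rewrite /Rintegral (@continuous_FTC2 _ _ F).
- rewrite /= /F !E1 !E2.
  have -> : t * (y + t^-1 - y) = 1 by field; rewrite gt_eqF.
  have -> : t * (y - t^-1 - y) = -1 by field; rewrite gt_eqF.
  have -> : t * (y - (y + t^-1)) = -1 by field; rewrite gt_eqF.
  have -> : t * (y - (y - t^-1)) = 1 by field; rewrite gt_eqF.
  by rewrite !(@smooth_step_le0 _ (- 1)) ?lerN10// !smooth_step_ge1//; ring.
- by lra.
- exact: continuous_subspaceT.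
- split; first by move=> x _; have [] := dF x.
  + by apply: cvg_at_right_filter; exact: cF.
  + by apply: cvg_at_left_filter; exact: cF.
- by move=> x _; rewrite derive1E; have [_ ->] := dF x.
Qed.

(** Since the mass is 2, the error is the integral of (z - z(y)) times the near part: at most e
    times 2 t K, over an interval of length 2/t. *)
Lemma near_part_approx (z : R -> R) y t e : 1 <= t -> continuous z ->
  (forall x, `|x - y| <= t^-1 -> `|z x - z y| <= e) ->
  `|(\int[mu]_x (z x * near_part t y x)) - 2 * z y| <= 4 * K * e.
Proof.
move=> t1 cz ze; have t0 : 0 < t by exact: lt_le_trans t1.
have ti0 : 0 < t^-1 by rewrite invr_gt0.
set D : set R := [set` `[y - t^-1, y + t^-1]].
have DE x : D x -> `|x - y| <= t^-1.
  by rewrite /D /= in_itv /= ler_norml; lra.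
have e0 : 0 <= e by apply: (le_trans (normr_ge0 _) (ze y _)); rewrite subrr normr0 ltW.
have mD : measurable D by exact: measurable_itv.
have iD (f : R -> R) : continuous f -> mu.-integrable D (EFin \o f).
  move=> cf; apply: continuous_compact_integrable; first exact: segment_compact.
  exact: continuous_subspaceT.
have -> : (\int[mu]_x (z x * near_part t y x)) = \int[mu]_(x in D) (z x * near_part t y x).
  rewrite [RHS]Rintegral_mkcond; apply: eq_Rintegral => x _.
  rewrite patchE; case: ifPn => //; rewrite notin_setE /D /= in_itv /= => /negP.
  rewrite negb_and -!ltNge => /orP xD.
  (* Farther than 1/t from [y], one argument of [s] exceeds 1 and the other is negative, so both
     terms vanish. *)
  have big w : t^-1 < w -> 1 < t * w /\ t * - w < 0.
    by move=> h; rewrite mulrN oppr_lt0 mulrC -ltr_pdivrMr// div1r pmulr_lgt0// (lt_trans ti0).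
  rewrite /near_part; case: xD => xD.
    have [|h1 h2] := big (y - x); first lra.
    by rewrite opprB in h2; rewrite (s0 h2) (s1 h1) !mulr0 addr0 mulr0.
  have [|h1 h2] := big (x - y); first lra.
  by rewrite opprB in h2; rewrite (s0 h2) (s1 h1) !mulr0 addr0 mulr0.
have cn := @continuous_near_part t y.
have cd : continuous (fun x => (z x - z y) * near_part t y x).
  by move=> x; apply: cvgM; [apply: cvgB; [exact: cz|exact: cvg_cst]|exact: cn].
have -> : (\int[mu]_(x in D) (z x * near_part t y x)) - 2 * z y =
    \int[mu]_(x in D) ((z x - z y) * near_part t y x).
  rewrite -(near_part_integral y t1) mulrC -RintegralZl//; last exact: iD.
  rewrite -RintegralB//; first by apply: eq_Rintegral => x _; ring.
    by apply: iD => x; apply: cvgM; [exact: cz|exact: cn].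
  by apply: iD => x; apply: cvgM; [exact: cvg_cst|exact: cn].
apply: le_trans (le_normr_Rintegral _ (iD _ cd)) _ => //.
have -> : 4 * K * e = \int[mu]_(x in D) (e * (2 * t * K)).
  have muD : mu D = (2 / t)%:E.
    rewrite /D lebesgue_measure_itv /= lte_fin ifT; last lra.
    by rewrite -EFinB; congr EFin; ring.
  rewrite Rintegral_cst// -[X in fine X]/(mu D) muD /=.
  by field; rewrite gt_eqF.
apply: le_Rintegral => //.
- exact: integrable_norm (iD _ cd).
- by apply: iD; exact: cst_continuous.
- by move=> x xD; rewrite normrM ler_pM// ?ze ?near_part_le//; exact: DE.
Qed.

(** The factor in front of [e] is independent of [t], so the error can be made arbitrarily small. *)
Lemma mollifier_approx u a y e : 0 < a -> continuous u -> L2fun u -> 0 < e ->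
  exists2 t, 1 <= t &
    `|(\int[mu]_x (u x * mollifier s a y t x)) - 2 * u y| <=
      (4 * K + 2 * K * (L2norm2 u + a^-1)) * e.
Proof.
move=> a0 cu Lu e0.
(* The peak is absorbed into the function sampled by the near part; it equals 1 at [y], so the
   sampled value is still [u y]. *)
pose z x := u x * peak a y x.
have cz : continuous z by move=> x; apply: cvgM; [exact: cu|exact: peak_continuous].
have zy : z y = u y by rewrite /z peak_center mulr1.
have /cvgrPdist_le/(_ _ e0)/nbhs_ballP[d /= d0 hd] := cz y.
(* The three summands ensure in turn 1 <= t, 1/t <= d/2 < d with [d] the modulus of continuity at
   [y], and 1/t <= e. *)
exists (1 + 2 / d + e^-1); first by rewrite -addrA lerDl addr_ge0// ltW ?invr_gt0 ?divr_gt0.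
set t := 1 + _ + _.
have t1 : 1 <= t by rewrite /t -addrA lerDl addr_ge0// ltW ?invr_gt0 ?divr_gt0.
have t0 : 0 < t by exact: lt_le_trans t1.
have te : t^-1 <= e.
  rewrite -[e]invrK lef_pV2 ?posrE ?invr_gt0// /t lerDr addr_ge0//.
  by rewrite ltW// divr_gt0.
have td : t^-1 < d.
  have : t^-1 <= d / 2.
    rewrite -[d / 2]invrK lef_pV2 ?posrE ?invr_gt0 ?divr_gt0// invfM invrK mulrC.
    rewrite /t -addrA addrC -addrA lerDl addr_ge0// ltW// invr_gt0//.
  by move=> h; apply: (le_lt_trans h); lra.
have Ln : L2fun (fun x => peak a y x * near_part t y x).
  by apply: (L2fun_peakM y a0 (@continuous_near_part t y)) => x; exact: near_part_le.
have Lf : L2fun (fun x => peak a y x * far_part t y x).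
  by apply: (L2fun_peakM y a0 (@continuous_far_part t y)) => x; exact: far_part_le.
have -> : (\int[mu]_x (u x * mollifier s a y t x)) =
    (\int[mu]_x (z x * near_part t y x))
    + \int[mu]_x (u x * (peak a y x * far_part t y x)).
  rewrite -RintegralD//; last exact: L2fun_integrableM Lu Lf.
    by apply: eq_Rintegral => x _; rewrite mollifierE /z; ring.
  have := L2fun_integrableM Lu Ln; apply: eq_integrable => // x _.
  by rewrite /= /z mulrA.
rewrite addrAC (le_trans (ler_normD _ _))// [leRHS]mulrDl lerD//.
  rewrite -zy; apply: near_part_approx => // x xt.
  by rewrite distrC; apply: hd; rewrite /ball/= distrC (le_lt_trans xt).
apply: (le_trans (far_part_integral y a0 t0 Lu)).
have B0 : 0 <= L2norm2 u + a^-1 by rewrite addr_ge0 ?L2norm2_ge0// invr_ge0 ltW.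
by rewrite mulrAC ler_wpM2l// mulr_ge0// mulr_ge0.
Qed.

End Bound.

(** With c = u(y) the test inequality becomes in the limit 4 a u(y)^2 <= |g|^2 + a^2 |u|^2 + 2 a
    u(y)^2. *)
Lemma H1_pointwise_bound u g a y : 0 < a -> H1_with_deriv u g ->
  2 * a * u y ^+ 2 <= L2norm2 g + a ^+ 2 * L2norm2 u.
Proof.
move=> a0 H; have [cu [Lu _]] := H.
have [s es [ds s0 s1 [K K0 sK]]] := @smooth_step_derive R.
set C := 4 * K + 2 * K * (L2norm2 u + a^-1).
have C0 : 0 <= C.
  by rewrite addr_ge0 ?mulr_ge0// addr_ge0 ?L2norm2_ge0// invr_ge0 ltW.
apply/ler_addgt0Pr => e e0.
(* Approximating to within e / B costs at most 2 |u(y)| a C e / B <= e; the added 1 keeps [B]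
   positive. *)
pose B := 2 * `|u y| * a * C + 1.
have B0 : 0 < B by rewrite ltr_wpDl// !mulr_ge0// ltW.
have [t t1 ht] := mollifier_approx es ds s0 s1 K0 sK y a0 cu Lu (divr_gt0 e0 B0).
have := test_inequality es ds s0 s1 sK (u y) y a0 t1 H.
set J := \int[mu]_x _ in ht *.
have hJ : 2 * `|u y| * a * `|J - 2 * u y| <= e.
  apply: (le_trans (ler_wpM2l _ ht)); first by rewrite !mulr_ge0// ltW.
  rewrite mulrA mulrCA ger_pMr// ler_pdivrMr// mul1r.
  by rewrite /B /C lerDl.
have hu : - (u y * (J - 2 * u y)) <= `|u y| * `|J - 2 * u y|.
  by rewrite -normrM -normrN ler_norm.
have := ler_wpM2l (ltW a0) hu.
have -> : a * - (u y * (J - 2 * u y)) = 2 * a * u y ^+ 2 - u y * a * J by ring.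
have -> : a * (`|u y| * `|J - 2 * u y|) = `|u y| * a * `|J - 2 * u y| by ring.
have -> : 2 * u y ^+ 2 * a = 2 * a * u y ^+ 2 by ring.
have -> : 2 * u y * a * J = 2 * (u y * a * J) by ring.
have E : 2 * `|u y| * a * `|J - 2 * u y| = 2 * (`|u y| * a * `|J - 2 * u y|) by ring.
rewrite E in hJ; lra.
Qed.

End LowerBound.

(** * The infimum and the best constant *)

Section SharpConstant.
Variable R : realType.
Local Notation mu := (@lebesgue_measure R).
Implicit Types (u g : R -> R) (a beta y x : R).

(** [sup] has its meaning only for a nonempty set bounded above and is a default value otherwise, so
    an explicit bound must be supplied. *)
Lemma sup_norm_bounds u B : (forall x, `|u x| <= B) ->
  (forall x, `|u x| <= sup_norm u) /\ sup_norm u <= B.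
Proof.
move=> uB; split=> [x|].
  by apply: ub_le_sup; [exists B => _ [z _ <-]|exists x].
by apply: ge_sup => [|_ [z _ <-]]; [exists `|u 0|; exists 0|].
Qed.

Lemma Ifun_alpha_delta a beta u g : L2fun u ->
  Ifun (alpha_delta_form (a ^+ 2) beta) u g =
  L2norm2 g + a ^+ 2 * L2norm2 u + beta * u 0 ^+ 2.
Proof.
move=> Lu; rewrite /Ifun /alpha_delta_form -mulrA -expr2 addrA.
congr (_ + _ + _); rewrite L2norm2_Rintegral -RintegralZl//; last first.
  exact: L2fun_integrable_sqr.
by apply: eq_Rintegral => x _; rewrite -mulrA -expr2.
Qed.

(** The pointwise bound is uniform in the point: it makes [sup_norm u] a genuine supremum S and
    gives 2 a S^2 <= T. The point term is then at least - beta_- u(0)^2 >= - beta_- S^2. *)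
Lemma Ifun_ge a beta u g : 0 < a -> H1_with_deriv u g ->
  (forall x, `|u x| <= sup_norm u) /\
  (2 * a - Num.max (- beta) 0) * sup_norm u ^+ 2 <=
    Ifun (alpha_delta_form (a ^+ 2) beta) u g.
Proof.
move=> a0 H; have [_ [Lu _]] := H; rewrite Ifun_alpha_delta//.
set T := L2norm2 g + _; have a20 : 0 < 2 * a by rewrite mulr_gt0.
have uT x : `|u x| <= Num.sqrt (T / (2 * a)).
  rewrite -sqrtr_sqr ler_wsqrtr// ler_pdivlMr// mulrC.
  exact: H1_pointwise_bound.
have [uS ST] := sup_norm_bounds uT; split => //.
have S0 : 0 <= sup_norm u := le_trans (normr_ge0 _) (uS 0).
have hS : 2 * a * sup_norm u ^+ 2 <= T.
  rewrite mulrC -ler_pdivlMr// -[leRHS]sqr_sqrtr ?lerXn2r ?nnegrE ?sqrtr_ge0//.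
  apply: divr_ge0 (ltW a20); apply: addr_ge0; first exact: L2norm2_ge0.
  by apply: mulr_ge0; [exact: sqr_ge0|exact: L2norm2_ge0].
have h0 : u 0 ^+ 2 <= sup_norm u ^+ 2.
  by rewrite -(real_normK (num_real (u 0))) lerXn2r ?nnegrE.
have m0 : 0 <= Num.max (- beta) 0 by rewrite le_max lexx orbT.
have mb : - beta <= Num.max (- beta) 0 by rewrite le_max lexx.
have := ler_wpM2l m0 h0; have := ler_wpM2r (sqr_ge0 (u 0)) mb; lra.
Qed.

Lemma sup_norm_peak a y : 0 < a -> sup_norm (peak a y) = 1.
Proof.
move=> a0; have [p1 p2] : (forall x, `|peak a y x| <= sup_norm (peak a y)) /\
    sup_norm (peak a y) <= 1.
  by apply: sup_norm_bounds => x; rewrite ger0_norm ?peak_ge0 ?peak_le1// ltW.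
by apply/eqP; rewrite eq_le p2 (le_trans _ (p1 y))// peak_center normr1.
Qed.

Lemma Ifun_peak a beta y : 0 < a ->
  Ifun (alpha_delta_form (a ^+ 2) beta) (peak a y) (peak_deriv a y) =
  2 * a + beta * peak a y 0 ^+ 2.
Proof.
move=> a0; rewrite Ifun_alpha_delta; last exact: L2fun_peak.
rewrite L2norm2_peak_deriv// L2norm2_peak//; field.
by rewrite gt_eqF.
Qed.

Lemma Ifun_peak_approx a beta e : 0 < a -> 0 < e -> exists y,
  Ifun (alpha_delta_form (a ^+ 2) beta) (peak a y) (peak_deriv a y) <=
  2 * a - Num.max (- beta) 0 + e.
Proof.
move=> a0 e0; have [b0|b0] := leP beta 0.
  exists 0; rewrite Ifun_peak// peak_center expr1n mulr1.
  by rewrite max_l ?oppr_ge0// opprK lerDl ltW.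
have w0 : 0 < beta / e by rewrite divr_gt0.
(* With w = beta / e the peak takes the value exp(- w) at 0, and beta exp(- w) <= e because exp(w)
   >= w. *)
exists (beta / e / a); rewrite Ifun_peak// max_r ?oppr_le0 ?(ltW b0)// subr0 lerD2l.
have p1 : peak a (beta / e / a) 0 ^+ 2 <= peak a (beta / e / a) 0.
  by rewrite expr2 ger_pMl ?peak_gt0// peak_le1// ltW.
apply: (le_trans (ler_wpM2l (ltW b0) p1)).
rewrite /peak sub0r normrN gtr0_norm ?divr_gt0// mulrCA divff ?gt_eqF// mulr1.
rewrite expRN ler_pdivrMr ?expR_gt0// mulrC -ler_pdivrMr//.
by rewrite (le_trans _ (expR_ge1Dx _))// lerDr.
Qed.

Lemma mV_alpha_delta a beta : 0 < a ->
  mV (alpha_delta_form (a ^+ 2) beta) = 2 * a - Num.max (- beta) 0.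
Proof.
move=> a0; rewrite /mV; set A := [set _ | _ in _].
have lbA : lbound A (2 * a - Num.max (- beta) 0).
  move=> _ [[u g] /= [H [x ux]] <-].
  have [uS hI] := Ifun_ge beta a0 H.
  have S0 : 0 < sup_norm u by rewrite (lt_le_trans _ (uS x))// normr_gt0.
  by rewrite ler_pdivlMr// exprn_gt0.
have inA y : A (Ifun (alpha_delta_form (a ^+ 2) beta) (peak a y) (peak_deriv a y)).
  exists (peak a y, peak_deriv a y) => /=; last by rewrite sup_norm_peak// expr1n divr1.
  split; first exact: H1_peak.
  by exists y; rewrite gt_eqF// peak_gt0.
(* [inf] is a true infimum here: [inA] shows the set nonempty and [lbA] bounds it below. *)
apply/eqP; rewrite eq_le; apply/andP; split; last first.
  by apply: lb_le_inf => //; eexists; exact: (inA 0).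
apply/ler_addgt0Pr => e e0; have [y hy] := Ifun_peak_approx beta a0 e0.
apply: le_trans hy; apply: ge_inf; last exact: inA.
by exists (2 * a - Num.max (- beta) 0).
Qed.

End SharpConstant.

Unset Implicit Arguments.
Set Strict Implicit.

Theorem theorem4p5 (R : realType) (alpha beta : R) (halpha : 0 < alpha) :
  mV (alpha_delta_form alpha beta)
    = 2 * Num.sqrt alpha - Num.max (- beta) 0
  /\
  (0 < 2 * Num.sqrt alpha + beta ->
     let C0 := (Num.sqrt (2 * Num.sqrt alpha - Num.max (- beta) 0))^-1 in
     (forall u g : R -> R, H1_with_deriv u g ->
        sup_norm u <= C0 * Num.sqrt (Ifun (alpha_delta_form alpha beta) u g))
     /\
     (forall C : R,
        (forall u g : R -> R, H1_with_deriv u g ->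
           sup_norm u <= C * Num.sqrt (Ifun (alpha_delta_form alpha beta) u g)) ->
        C0 <= C)).
Proof.
have [a a0 ->] : exists2 a, 0 < a & alpha = a ^+ 2.
  by exists (Num.sqrt alpha); rewrite ?sqrtr_gt0// sqr_sqrtr// ltW.
rewrite sqrtr_sqr gtr0_norm//; split; first exact: mV_alpha_delta.
move=> ab; set m := 2 * a - _ => C0.
have m0 : 0 < m by rewrite /m maxEle; case: ifP => _; lra.
have sm0 : 0 < Num.sqrt m by rewrite sqrtr_gt0.
split=> [u g H|C hC].
  have [uS hI] := Ifun_ge beta a0 H.
  have S0 : 0 <= sup_norm u := le_trans (normr_ge0 _) (uS 0).
  rewrite ler_pdivlMl// -[sup_norm u](ger0_norm S0) -sqrtr_sqr -sqrtrM ?(ltW m0)//.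
  exact: ler_wsqrtr.
have peakC y : 1 <= C * Num.sqrt (Ifun (alpha_delta_form (a ^+ 2) beta)
    (peak a y) (peak_deriv a y)).
  by have := hC _ _ (H1_peak y a0); rewrite sup_norm_peak.
(* No sign is assumed for [C]; a nonpositive one would contradict the inequality for the peak at
   0. *)
have C_gt0 : 0 < C.
  rewrite ltNge; apply/negP => C_le0; have := peakC 0.
  by rewrite leNgt (le_lt_trans _ ltr01)// mulr_le0_ge0// sqrtr_ge0.
(* Passing to inverses and squares leaves C^-2 <= m, which follows from C^-2 <= J <= m + e for a
   suitable peak. *)
rewrite /C0 -[leRHS]invrK lef_pV2 ?posrE ?invr_gt0//.
rewrite -[leLHS]ger0_norm ?invr_ge0 ?(ltW C_gt0)// -sqrtr_sqr ler_wsqrtr//.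
apply/ler_addgt0Pr => e e0; have [y hy] := Ifun_peak_approx beta a0 e0.
apply: le_trans hy; have := peakC y; rewrite mulrC -ler_pdivrMr// div1r => hC'.
set J := Ifun _ _ _ in hC' *.
(* [Num.sqrt] is 0 on negative numbers, so positivity of [J] is read off from its root being at
   least 1/C. *)
have J0 : 0 < J by rewrite -sqrtr_gt0 (lt_le_trans _ hC')// invr_gt0.
by rewrite -[leRHS]sqr_sqrtr ?(ltW J0)// lerXn2r ?nnegrE ?sqrtr_ge0// invr_ge0 ltW.
Qed.
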